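(* Every ideal on $\omega$ isomorphic to $\mathcal{WR}$ is Mon.
   Context: An ideal on a countable set $X$ is a collection $\mathcal{I}\subset\mathcal{P}(X)$ closed under subsets and finite unions, with $\mathcal{I}\neq\mathcal{P}(X)$ and containing all finite subsets of $X$. A family $\mathcal{G}$ generates $\mathcal{I}$ if $\mathcal{I}$ consists of all sets covered by finitely many members of $\mathcal{G}$. $\mathcal{WR}$ is the ideal on $\omega\times\omega$ generated by the vertical lines $\{n\}\times\omega$, $n\in\omega$, together with all sets $G\subset\omega\times\omega$ such that for every two distinct points $(i,j),(k,l)\in G$ either $i>k+l$ or $k>i+j$. Ideals $\mathcal{I}$ and $\mathcal{J}$ are isomorphic if there is a bijection $f:\bigcup\mathcal{J}\to\bigcup\mathcal{I}$ such that $A\in\mathcal{I}\Leftrightarrow f^{-1}[A]\in\mathcal{J}$. An ideal $\mathcal{I}$ on $\omega$ is Mon if for every sequence of reals $(x_n)_{n\in\omega}$ there is $M\subset\omega$, $M\notin\mathcal{I}$, such that the subsequence $(x_n)_{n\in M}$ is monotone (nonincreasing or nondecreasing). *)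

(* Defs.v *)
From HB Require Import structures.
From mathcomp Require Import all_boot all_order all_algebra.
From mathcomp Require Import boolp classical_sets functions cardinality reals.
Set Implicit Arguments.
Unset Strict Implicit.
Unset Printing Implicit Defensive.

Local Open Scope classical_set_scope.

Record is_ideal (T : countType) (I : set (set T)) : Prop := IsIdeal {
  ideal_sub : forall A B : set T, A `<=` B -> I B -> I A;
  ideal_setU : forall A B : set T, I A -> I B -> I (A `|` B);
  ideal_proper : I <> setT;
  ideal_finite : forall A : set T, finite_set A -> I A }.

Definition generated (T : Type) (G : set (set T)) : set (set T) :=
  [set A | exists2 F : set (set T),
    finite_set F /\ F `<=` G & A `<=` \bigcup_(B in F) B].

Definition WR_line (n : nat) : set (nat * nat) := [set p | p.1 = n].

Definition WR_sparse (G : set (nat * nat)) : Prop :=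
  forall i j k l : nat, G (i, j) -> G (k, l) -> (i, j) <> (k, l) ->
    (k + l < i)%N \/ (i + j < k)%N.

Definition WR : set (set (nat * nat)) :=
  generated (range WR_line `|` [set G | WR_sparse G]).

(* f lives on the whole type T, but only its restriction to the union of J
   matters, hence the intersection in the preimage. *)
Definition isomorphic (U T : Type) (I : set (set U)) (J : set (set T)) : Prop :=
  let XI := \bigcup_(A in I) A in
  let XJ := \bigcup_(B in J) B in
  exists2 f : T -> U, set_bij XJ XI f &
    forall A : set U, A `<=` XI -> (I A <-> J (XJ `&` f @^-1` A)).

Definition monotone_on (R : realType) (M : set nat) (x : nat -> R) : Prop :=
  (forall m n : nat, M m -> M n -> (m <= n)%N -> (x n <= x m)%R) \/
  (forall m n : nat, M m -> M n -> (m <= n)%N -> (x m <= x n)%R).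

Definition Mon (R : realType) (I : set (set nat)) : Prop :=
  forall x : nat -> R, exists2 M : set nat, ~ I M & monotone_on M x.

(* Main.v *)
Require Import Defs.
From mathcomp Require Import all_boot all_order all_algebra.
From mathcomp Require Import classical_sets reals.
From mathcomp Require Import boolp cardinality filter.

(** Read a point (i, j) as the interval [i, i + j] of natural numbers.  Two
distinct points satisfy the sparseness condition exactly when their intervals
are disjoint, so a set is outside WR as soon as it contains arbitrarily large
finite families of pairwise intersecting intervals with distinct left ends:
finitely many lines and sparse sets cannot separate such families, by the
pigeonhole principle.  A sequence p with one point in each of infinitely many
columns has this property if the interval of p n always reaches the column of
p (2n): then the points p K, ..., p (2K) have pairwise intersecting intervals
([wide_sequence_notin_WR]).

An isomorphism turns a sequence of reals into a total preorder le on the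
points, and the order of the indices into an injection f of the points into
nat.  It remains to find p as above along which f increases and le is
monotone.  Both the reach of the interval and f are eventually large as one
climbs inside a column, so only le matters.  Each column has an infinite subset
climbing monotonically for le; by symmetry these subsets may all be taken
nondecreasing.  Comparing the limits of the columns, after thinning out the
columns one of two things happens.  Either each column is eventually above any
given value of the previous one, and p is chosen nondecreasing; or each column
contains a value that dominates the whole next column, and p is nonincreasing
as soon as p n is chosen above that value in its column
([wide_transversal_of_chains]). *)

Set Implicit Arguments.
Unset Strict Implicit.
Unset Printing Implicit Defensive.

Local Open Scope classical_set_scope.
Local Open Scope card_scope.

Lemma WR_downward (A B : set (nat * nat)) : A `<=` B -> WR B -> WR A.
Proof. by move=> AB [F HF BF]; exists F => //; apply: subset_trans BF. Qed.

Lemma bigcup_WR : \bigcup_(A in WR) A = setT.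
Proof.
apply/seteqP; split=> // -[i j] _; exists (WR_line i) => //.
exists [set WR_line i]; last by move=> p Hp; exists (WR_line i).
by split=> // _ ->; left; exists i.
Qed.

(** In a cover of the range by K sets, two of the K + 1 points
p K, ..., p (2K) fall into the same set.  It is not a line, since the columns
differ; it is not sparse, since the interval of p (K + a) reaches the column of
p (2(K + a)), which is at or beyond that of p (2K). *)
Lemma wide_sequence_notin_WR (p : nat -> nat * nat) :
    {homo (fun n => (p n).1) : m n / m < n} ->
    (forall n, (p n.*2).1 <= (p n).1 + (p n).2) ->
  ~ WR (range p).
Proof.
move=> col_incr wide [F [[K FK] FG] pF].
have pB n : exists B, F B /\ B (p n).
  by have [|B FB Bp] := pF (p n); [exists n | exists B].
have [B HB] := choice pB.
(* Injectivity would contradict the pigeonhole principle; it is established by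
   ruling out that the two points share a line or a sparse set. *)
have B_inj : {in `I_K.+1 &, injective (fun a => B (K + a))}.
  suff neqB a b : a <= K -> b <= K -> a < b -> B (K + a) <> B (K + b).
    move=> a b; rewrite !inE /= !ltnS => aK bK eqB.
    by case: (ltngtP a b) => // ab; [case: (neqB a b) | case: (neqB b a)].
  move=> aK bK ab eqB.
  have [FB Bb] := HB (K + b); have [_] := HB (K + a); rewrite eqB => Ba.
  have col_ab : (p (K + a)).1 < (p (K + b)).1.
    by apply: col_incr; rewrite ltn_add2l.
  have col_b_le : (p (K + b)).1 <= (p (K + a)).1 + (p (K + a)).2.
    apply: leq_trans (wide (K + a)).
    apply: (ltnW_homo col_incr); rewrite -addnn addnACA.
    by rewrite (leq_trans (leq_add (leqnn K) bK))// leq_addr.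
  case: (FG _ FB) => [[i _ lineB]|sparseB].
    move: Ba Bb; rewrite -lineB /WR_line /= => Ea Eb.
    by rewrite Ea Eb ltnn in col_ab.
  case: (sparseB (p (K + a)).1 (p (K + a)).2 (p (K + b)).1 (p (K + b)).2).
  - by rewrite -surjective_pairing.
  - by rewrite -surjective_pairing.
  - by case=> E; rewrite E ltnn in col_ab.
  - by move/(leq_ltn_trans (leq_addr _ _)); rewrite ltnNge (ltnW col_ab).
  - by rewrite ltnNge col_b_le.
have: `I_K.+1 #<= `I_K.
  rewrite -(card_le_eql (inj_card_eq B_inj)) -(card_le_eqr FK).
  by apply: subset_card_le => _ [a _ <-]; case: (HB (K + a)).
by rewrite card_le_II ltnn.
Qed.

Lemma injective_near_gt (g : nat -> nat) (b : nat) :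
  injective g -> \forall k \near \oo, b < g k.
Proof.
move=> g_inj.
have near_neq v : \forall k \near \oo, g k <> v.
  have [[k0 <-]|no] := pselect (exists k, g k = v).
    by exists k0.+1 => // k /= k0k /g_inj E; rewrite E ltnn in k0k.
  by exists 0 => // k _ E; apply: no; exists k.
elim: b => [|b IH].
  by apply: filterS (near_neq 0) => k /eqP; rewrite lt0n.
apply: filterS2 IH (near_neq b.+1) => k.
by rewrite leq_eqVlt => /predU1P[->|].
Qed.

(** The peak argument for monotone subsequences, for an arbitrary relation: a
peak is an index r-related to no later one.  Without peaks beyond some N, an
r-chain can be built greedily; otherwise the peaks form an infinite sequence.
A greedy chain only controls consecutive terms; when r is transitive this
extends to all pairs. *)
Lemma homogeneous_consecutive (r : nat -> nat -> Prop) :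
  exists2 u : nat -> nat, {homo u : m n / m < n} &
    (forall n, r (u n) (u n.+1)) \/ (forall n, ~ r (u n) (u n.+1)).
Proof.
have incr u : (forall n, u n < u n.+1) -> {homo u : m n / m < n}.
  by move=> u_lt; apply: homo_ltn => //; exact: ltn_trans.
(* The implication sits inside the existential so that a choice function is
   defined on all indices, including those below N. *)
have [[N chain]|no_chain] :=
    pselect (exists N, forall n, exists m, N <= n -> n < m /\ r n m).
  have [g Hg] := choice chain.
  have ge_N n : N <= iter n g N.
    by elim: n => //= n IH; have [/ltnW + _] := Hg _ IH; apply: leq_trans.
  exists (fun n => iter n g N); [apply: incr => n|left => n].
  - by have [] := Hg _ (ge_N n).
  - by have [] := Hg _ (ge_N n).
have peaks N : exists n, N <= n /\ forall m, n < m -> ~ r n m.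
  apply: contrapT => no; apply: no_chain; exists N => n.
  apply: contrapT => no_m; apply: no; exists n; split.
    by apply: contrapT => Nn; apply: no_m; exists 0.
  by move=> m nm rnm; apply: no_m; exists m.
have [g Hg] := choice peaks.
pose u n := iter n (g \o succn) (g 0).
have u_lt n : u n < u n.+1 by have [] := Hg (u n).+1.
exists u; [exact: incr|right] => n.
have [a u_a] : exists a, u n = g a.
  by case: n => [|n]; [exists 0 | exists (u n).+1].
have [_ peak] := Hg a.
by rewrite {1}u_a; apply: peak; rewrite -u_a; exact: u_lt.
Qed.

(** Dependent choice, in the form needed to select one point per column: the
constraint between columns n and n + 1 can be met by every point far enough up
column n + 1. *)
Lemma eventual_path (E : nat -> nat -> nat -> Prop) :
    (forall n k, \forall l \near \oo, E n k l) ->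
  exists s : nat -> nat, forall n, E n (s n) (s n.+1).
Proof.
move=> evE.
have step (q : nat * nat) : exists l, E q.1 q.2 l.
  by have [N _ HN] := evE q.1 q.2; exists N; apply: HN => /=.
have [g Hg] := choice step.
pose s := fix s n := if n is m.+1 then g (m, s m) else 0.
by exists s => n; apply: (Hg (n, s n)).
Qed.

(** The second condition says that the interval of the n-th point reaches the
left end of the interval of the 2n-th one. *)
Definition wide_transversal (f : nat * nat -> nat) (p : nat -> nat * nat) :=
  [/\ {homo (fun n => (p n).1) : m n / m < n},
      forall n, (p n.*2).1 <= (p n).1 + (p n).2 &
      {homo f \o p : m n / m < n}].

(** The columns c n carry le-nondecreasing sequences n, k |-> (c n, phi n k).
The relation of column n to column m used to thin out the columns expresses
that the limit of the former is at most that of the latter; it is stated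
as cofinality, which also settles whether limits are attained. *)
Lemma wide_transversal_of_chains (f : nat * nat -> nat) (le : rel (nat * nat))
    (c : nat -> nat) (phi : nat -> nat -> nat) :
    injective f -> transitive le -> total le ->
    {homo c : m n / m < n} -> (forall n, {homo phi n : k l / k < l}) ->
    (forall n k, le (c n, phi n k) (c n, phi n k.+1)) ->
  exists2 p, wide_transversal f p &
    (forall n, le (p n) (p n.+1)) \/ (forall n, le (p n.+1) (p n)).
Proof.
move=> f_inj le_tr le_tot.
wlog: c phi / (forall n k, exists l, le (c n, phi n k) (c n.+1, phi n.+1 l)) \/
    (forall n, exists k, forall l, le (c n.+1, phi n.+1 l) (c n, phi n k)).
  move=> wlg c_incr phi_incr phi_le.
  pose r n m := forall k, exists l, le (c n, phi n k) (c m, phi m l).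
  have [u u_incr ur] := homogeneous_consecutive r.
  apply: (wlg (c \o u) (phi \o u)) => [|m n mn|n|n k] /=.
  - case: ur => [ur|ur]; [left => n; exact: ur|right => n].
    have /existsNP[k no_l] := ur n; exists k => l.
    case/orP: (le_tot (c (u n), phi (u n) k)
                      (c (u n.+1), phi (u n.+1) l)) => // le_kl.
    by case: no_l; exists l.
  - exact/c_incr/u_incr.
  - exact: phi_incr.
  - exact: phi_le.
move=> consec c_incr phi_incr phi_le.
have chain n k l : k <= l -> le (c n, phi n k) (c n, phi n l).
  apply: (homo_leq (f := fun k => (c n, phi n k)) (r := le)) => // q.
  by have := le_tot q q; rewrite orbb.
pose pt n k := (c n, phi n k).
have f_near n b : \forall l \near \oo, b < f (pt n l).
  apply: injective_near_gt => k l /f_inj[] phi_kl.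
  by case: (ltngtP k l) => // /(phi_incr n); rewrite phi_kl ltnn.
have phi_near n b : \forall l \near \oo, b <= phi n l.
  have phi_inj : injective (phi n).
    move=> k l phi_kl.
    by case: (ltngtP k l) => // /(phi_incr n); rewrite phi_kl ltnn.
  by apply: filterS (injective_near_gt b phi_inj) => l /ltnW.
(* The index is shifted by one because a path constrains each point by its
   predecessor, so nothing is known about the initial point. *)
suff [s [s_f s_phi] s_le] : exists2 s : nat -> nat,
    (forall n, f (pt n.+1 (s n.+1)) < f (pt n.+2 (s n.+2))) /\
    (forall n, c n.*2.+1 <= phi n.+1 (s n.+1)) &
    (forall n, le (pt n.+1 (s n.+1)) (pt n.+2 (s n.+2))) \/
    (forall n, le (pt n.+2 (s n.+2)) (pt n.+1 (s n.+1))).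
  exists (fun n => pt n.+1 (s n.+1)) => //; split=> [m n mn|n|] /=.
  - exact: c_incr.
  - exact: leq_trans (s_phi n) (leq_addl _ _).
  - by apply: homo_ltn => [//|n]; [exact: ltn_trans | exact: s_f].
case: consec => [up|down].
  have [|s Hs] := @eventual_path (fun n k l =>
    [/\ f (pt n k) < f (pt n.+1 l), c n.*2.+1 <= phi n.+1 l &
        le (pt n k) (pt n.+1 l)]).
    move=> n k; have [l0 le_l0] := up n k.
    near=> l; split; first by near: l; exact: f_near.
      by near: l; exact: phi_near.
    by apply: le_tr le_l0 _; apply: chain; near: l; exists l0.
  exists s; [split=> n|left=> n].
  - by have [] := Hs n.+1.
  - by have [] := Hs n.
  - by have [] := Hs n.+1.
(* K n is the height in column n of a value dominating column n + 1; going
   above K n in each column makes every choice in the next column smaller. *)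
have [K HK] := choice down.
have [|s Hs] := @eventual_path (fun n k l =>
  [/\ f (pt n k) < f (pt n.+1 l), c n.*2.+1 <= phi n.+1 l & K n.+1 <= l]).
  move=> n k; near=> l; split; first by near: l; exact: f_near.
    by near: l; exact: phi_near.
  by near: l; exists (K n.+1).
exists s; [split=> n|right=> n].
- by have [] := Hs n.+1.
- by have [] := Hs n.
- have [_ _ Ks] := Hs n.
  exact: le_tr (HK n.+1 _) (chain _ _ _ Ks).
Unshelve. all: by end_near.
Qed.

(** Infinitely many columns have a nondecreasing chain, or infinitely many have
a nonincreasing one; the latter case is the former for the converse preorder. *)
Lemma monotone_wide_transversal (f : nat * nat -> nat) (le : rel (nat * nat)) :
    injective f -> transitive le -> total le ->
  exists2 p, wide_transversal f p &
    (forall n, le (p n) (p n.+1)) \/ (forall n, le (p n.+1) (p n)).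
Proof.
move=> f_inj le_tr le_tot.
pose ge p q := le q p.
have ge_tr : transitive ge by move=> q p r pq qr; exact: le_tr qr pq.
have ge_tot : total ge by move=> p q; exact: le_tot.
pose up i (u : nat -> nat) := forall k, le (i, u k) (i, u k.+1).
pose dn i (u : nat -> nat) := forall k, ge (i, u k) (i, u k.+1).
have column i : exists u : nat -> nat,
    {homo u : k l / k < l} /\ (up i u \/ dn i u).
  have [u u_incr ur] := homogeneous_consecutive (fun j j' => le (i, j) (i, j')).
  exists u; split=> //; case: ur => [|ur]; [by left|right=> k].
  by have /orP[/ur|] := le_tot (i, u k) (i, u k.+1).
have [phi Hphi] := choice column.
(* A relation that ignores its second argument turns the homogeneity lemma
   into the infinite pigeonhole principle for the two types of columns. *)
have [c c_incr c_up] := homogeneous_consecutive (fun i _ => up i (phi i)).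
have phi_incr n : {homo phi (c n) : k l / k < l} by case: (Hphi (c n)).
case: c_up => [c_up|c_dn].
  exact: (@wide_transversal_of_chains f le c (phi \o c)).
have [||p p_wide p_mono] :=
  @wide_transversal_of_chains f ge c (phi \o c) f_inj ge_tr ge_tot c_incr.
- exact: phi_incr.
- by move=> n; case: (Hphi (c n)) => _ [/c_dn|].
by exists p => //; case: p_mono; [right|left].
Qed.

Theorem theorem1p4 (R : realType) (I : set (set nat)) (hI : is_ideal I)
  (hWR : isomorphic I WR) : Mon R I.
Proof.
case: hWR => f; rewrite bigcup_WR => -[f_dom f_inj _] I_WR x.
have f_inj' : injective f by move=> p q; apply: f_inj; rewrite inE.
have [|||p [col_incr wide fp_incr] p_mono] :=
    @monotone_wide_transversal f (fun p q => x (f p) <= x (f q))%R.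
- exact: f_inj'.
- by move=> q p r; exact: Order.POrderTheory.le_trans.
- by move=> p q; exact: Order.TotalTheory.le_total.
exists (range (f \o p)).
  have sub : range (f \o p) `<=` \bigcup_(A in I) A.
    by move=> _ [n _ <-]; apply: f_dom.
  move/(I_WR _ sub)/WR_downward => WRp.
  apply: (wide_sequence_notin_WR col_incr wide); apply: WRp.
  by move=> _ [n _ <-]; split=> //; exists n.
have fp_le a b : f (p a) <= f (p b) -> a <= b.
  by apply: contraTT; rewrite -!ltnNge => /fp_incr.
have x_trans := @Order.POrderTheory.le_trans _ R.
case: p_mono => p_mono; [right|left] => _ _ [a _ <-] [b _ <-] /fp_le.
- apply: (homo_leq (f := fun n => x (f (p n)))
    (r := fun y z => (y <= z)%R)) => // ? ? ?; exact: x_trans.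
- apply: (homo_leq (f := fun n => x (f (p n)))
    (r := fun y z => (z <= y)%R)) => // y w z yw wz; exact: x_trans wz yw.
Qed.
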